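(* Let $F \subseteq \mathbb{R}^d$ be any non-empty set and let $1 \leq k < d$ be an integer. Let $P \subseteq \mathbb{R}^n$ be a Borel set with positive $n$-dimensional Lebesgue measure which parameterises a family of projections $\{\pi_t \in G_{d,k} : t \in P\}$, where the map $t \mapsto \pi_t$ is a bijection from $P$ onto this family. Then for almost all $t \in P$ we have $$\dim_{\mathrm{A}} \pi_t F \ \geq\ \inf\Big\{ \underset{s \in P}{\mathrm{ess\,inf}}\ \dim_{\mathrm{A}} \pi_s E \ : \ E \in \mathcal{K}(\mathbb{R}^d),\ \dim_{\mathrm{H}} E = \dim_{\mathrm{A}} F \Big\}.$$
   Context: For integers $1 \leq k < d$, $G_{d,k}$ is the Grassmannian manifold of $k$-dimensional linear subspaces of $\mathbb{R}^d$; each subspace $V$ is identified with the orthogonal projection $\pi : \mathbb{R}^d \to V$, so elements of $G_{d,k}$ are regarded as orthogonal projections. $\pi F = \pi(F)$ is the image of $F$. ''Almost all $t \in P$'' and the essential infimum over $s \in P$ are with respect to $n$-dimensional Lebesgue measure on $P$: $\mathrm{ess\,inf}_{s\in P} f(s)$ is the supremum of all $c$ such that $f(s) \geq c$ for almost all $s \in P$. $\mathcal{K}(\mathbb{R}^d)$ is the set of all non-empty compact subsets of $\mathbb{R}^d$, and $\dim_{\mathrm{H}}$ denotes Hausdorff dimension. For a non-empty bounded set $E \subset \mathbb{R}^d$ and $r>0$, $N_r(E)$ is the smallest number of open sets of diameter at most $r$ required to cover $E$. The Assouad dimension of a non-empty set $F \subseteq \mathbb{R}^d$ is $$\dim_{\mathrm{A}}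 F = \inf\Big\{ s \geq 0 : (\exists C>0)(\forall R>0)(\forall r \in (0,R))(\forall x \in F)\ N_r(B(x,R)\cap F) \leq C (R/r)^s \Big\},$$ where $B(x,R)$ is the closed ball with centre $x$ and radius $R$. *)

(* Defs.v *)
From HB Require Import structures.
From mathcomp Require Import all_boot all_order all_algebra.
From mathcomp Require Import all_classical all_reals all_analysis.
From mathcomp Require Import measurable_realfun.

Set Implicit Arguments.
Unset Strict Implicit.
Unset Printing Implicit Defensive.

Import Order.TTheory GRing.Theory Num.Theory.
Import numFieldNormedType.Exports.

Local Open Scope classical_set_scope.
Local Open Scope ring_scope.

Section Euclidean.
Context {R : realType} {d : nat}.
Implicit Types (x y v : 'rV[R]_d) (A E F : set 'rV[R]_d).

(* The library's norm on row vectors is the sup norm. *)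
Definition dotp x y : R := \sum_(i < d) x 0 i * y 0 i.

Definition enorm x : R := Num.sqrt (dotp x x).

Definition eball x (r : R) : set 'rV[R]_d := [set y | enorm (y - x) <= r].

(* Equal to -oo on the empty set. *)
Definition ediam A : \bar R :=
  ereal_sup [set (enorm (xy.1 - xy.2))%:E | xy in A `*` A].

Definition covers_with (r : R) E (m : nat) : Prop :=
  exists U : 'I_m -> set 'rV[R]_d,
    (forall i, open (U i) /\ (ediam (U i) <= r%:E)%E) /\
    E `<=` \bigcup_i U i.

Definition covering_number (r : R) E : \bar R :=
  ereal_inf [set (m%:R)%:E | m in covers_with r E].

Definition assouad_dim F : \bar R :=
  ereal_inf [set s%:E | s in [set s : R | 0 <= s /\
    exists2 C : R, 0 < C & forall rho r : R, 0 < r -> r < rho ->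
      forall x, F x ->
        (covering_number r (eball x rho `&` F) <= (C * (rho / r) `^ s)%:E)%E]].

(* diam(U)^s, with the convention that the empty set contributes 0, for s = 0
   as well. *)
Definition diam_pow (s : R) A : \bar R :=
  if A == set0 then 0%E else poweR (ediam A) s.

Definition hausdorff_content (s delta : R) E : \bar R :=
  ereal_inf [set (\sum_(0 <= k <oo) diam_pow s (U k))%E |
    U in [set U : (set 'rV[R]_d)^nat |
      (forall k, (ediam (U k) <= delta%:E)%E) /\ E `<=` \bigcup_k U k]].

Definition hausdorff_measure (s : R) E : \bar R :=
  ereal_sup [set hausdorff_content s delta E | delta in [set e : R | 0 < e]].

Definition hausdorff_dim E : \bar R :=
  ereal_inf [set s%:E | s in [set s : R | 0 <= s /\
    hausdorff_measure s E = 0%E]].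

Definition orthogonal_projection_on (V : {vspace 'rV[R]_d})
    (p : 'rV[R]_d -> 'rV[R]_d) : Prop :=
  forall x, p x \in V /\ (forall v, v \in V -> dotp (x - p x) v = 0).

End Euclidean.

(* G_{d,k}, each subspace being identified with the orthogonal projection
   onto it. *)
Definition grassmannian (R : realType) (d k : nat) :
    set ('rV[R]_d -> 'rV[R]_d) :=
  [set p | exists2 V : {vspace 'rV[R]_d}, \dim V = k &
    orthogonal_projection_on V p].
Arguments grassmannian R d k : clear implicits.

(* R^n with its Borel sigma-algebra. *)
Definition borel_rV (R : realType) (n : nat) :=
  g_sigma_algebraType (@open 'rV[R]_n).

HB.instance Definition _ (R : realType) (n : nat) :=
  Measurable.on (borel_rV R n).

(* The n-dimensional Lebesgue measure on the Borel sets of R^n, by induction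
   on n: Lebesgue measure on R^(n+1) = R x R^n is the product measure. *)
Section LebesgueRow.
Context {R : realType}.
Let T := measurableTypeR R.

Definition cons_row n (p : T * borel_rV R n) : borel_rV R n.+1 :=
  row_mx ((p.1 : R)%:M : 'M[R]_1) (p.2 : 'rV[R]_n).

Definition head_row n (u : borel_rV R n.+1) : T := (u : 'rV[R]_n.+1) 0 0.

Definition tail_row n (u : borel_rV R n.+1) : borel_rV R n :=
  rsubmx (u : 'rV[R]_(1 + n)).

Lemma cons_row0 n p : (@cons_row n p : 'rV[R]_n.+1) 0 0 = p.1.
Proof. by rewrite /cons_row mxE; case: splitP => // j _; rewrite !ord1 mxE. Qed.

Lemma cons_rowS n p (j : 'I_n) :
  (@cons_row n p : 'rV[R]_n.+1) 0 (lift 0 j) = (p.2 : 'rV[R]_n) 0 j.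
Proof.
rewrite /cons_row mxE; case: splitP => [k|k]; first by rewrite ord1.
by move=> /= /eqP; rewrite /bump /= eqSS => /eqP/ord_inj ->.
Qed.

Lemma head_cons n p : head_row (@cons_row n p) = p.1.
Proof. exact: cons_row0. Qed.

Lemma tail_cons n p : tail_row (@cons_row n p) = p.2.
Proof. by rewrite /tail_row /cons_row row_mxKr. Qed.

Lemma open_measurable_rV n (U : set 'rV[R]_n) :
  open U -> measurable (U : set (borel_rV R n)).
Proof. exact: sub_sigma_algebra. Qed.

Lemma measurable_head_row n : measurable_fun [set: _] (@head_row n).
Proof.
apply: (measurability _ (RGenOpens.measurableE R)) =>
  _ [_ [a [b ->]] <-].
rewrite setTI; apply: open_measurable_rV.
apply: open_comp; last exact: interval_open.
by move=> x _; exact: coord_continuous.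
Qed.

Lemma measurable_tail_row n : measurable_fun [set: _] (@tail_row n).
Proof.
apply: (@measurability _ _ (borel_rV R n.+1) (borel_rV R n) _ _
  (@open 'rV[R]_n) erefl) => _ [U oU <-].
rewrite setTI; apply: open_measurable_rV.
apply: (open_comp (f := rsubmx : 'rV[R]_(1 + n) -> 'rV[R]_n)) => // x _.
exact: continuous_rsubmx.
Qed.

Lemma cons_row_ball n (x : 'rV[R]_n.+1) (e : R) : 0 < e ->
  @cons_row n @^-1` (ball x e : set 'rV[R]_n.+1) =
  (ball (x 0 0) e : set R) `*` (ball (rsubmx (x : 'rV[R]_(1 + n))) e).
Proof.
move=> e0; apply/seteqP; split => [p [_ xp]|p [/= xp1 [_ xp2]]].
  split; first by rewrite -(cons_row0 p); exact: xp.
  split=> // i j; rewrite !ord1 mxE -(cons_rowS p).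
  by rewrite (_ : rshift 1 j = lift 0 j); [exact: xp|exact: ord_inj].
split=> // i j; rewrite ord1; case: (unliftP 0 j) => [k|] ->.
  rewrite cons_rowS; have := xp2 0 k; rewrite mxE.
  by rewrite (_ : rshift 1 k = lift 0 k)//; exact: ord_inj.
by rewrite cons_row0.
Qed.

Lemma measurable_cons_row n : measurable_fun [set: _] (@cons_row n).
Proof.
apply: (@measurability _ _ (T * borel_rV R n)%type (borel_rV R n.+1) _ _
  (@open 'rV[R]_n.+1) erefl) => _ [U oU <-]; rewrite setTI.
pose rball (qk : 'rV[rat]_n.+1 * nat) : set 'rV[R]_n.+1 :=
  ball (map_mx ratr qk.1 : 'rV[R]_n.+1) qk.2.+1%:R^-1.
pose F qk : set 'rV[R]_n.+1 := if `[< rball qk `<=` U >] then rball qk else set0.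
have -> : U = \bigcup_qk F qk.
  apply/seteqP; split=> [u Uu|u [qk _]]; last first.
    by rewrite /F; case: asboolP => // + ?; exact.
  have /nbhs_ballP[e /= e0 eU] := open_nbhs_nbhs (conj oU Uu).
  have [k ke] : exists k, k.+1%:R^-1 + k.+1%:R^-1 < e :> R.
    have e20 : 0 < e / 2 by rewrite divr_gt0.
    have [k _ /(_ k (leqnn k))/= ke] := near_infty_natSinv_lt (PosNum e20).
    by exists k; rewrite [ltRHS]splitr ltrD.
  have k0 : 0 < k.+1%:R^-1 :> R by rewrite invr_gt0.
  have qP i : exists q : rat, ball (u 0 i) k.+1%:R^-1 (ratr q : R).
    have [|q] := @rat_in_itvoo R (u 0 i - k.+1%:R^-1) (u 0 i + k.+1%:R^-1).
      by rewrite ltrBlDr -addrA ltrDl addr_gt0.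
    rewrite in_itv/= => /andP[q1 q2]; exists q.
    by rewrite /ball/= ltr_distlC q1 q2.
  have [q uq] := choice qP.
  have Bu : rball (\row_i q i, k) u.
    by split=> // i j; rewrite !mxE ord1; exact/ball_sym.
  exists (\row_i q i, k) => //; rewrite /F asboolT// => v Bv.
  apply: eU; apply: le_ball (ltW ke) _ _.
  by apply: ball_triangle Bv; exact/ball_sym.
rewrite preimage_bigcup; apply: countable_bigcupT_measurable => [|qk].
  exact: countableP.
rewrite /F; case: ifPn => _; last by rewrite preimage_set0.
rewrite cons_row_ball ?invr_gt0//; apply: measurableX.
  by apply: open_measurable; exact: ball_open.
by apply: open_measurable_rV; exact: ball_open.
Qed.

Section Step.
Context n (m : {sigma_finite_measure set (borel_rV R n) -> \bar R}).

Definition lebesgue_cons : set (borel_rV R n.+1) -> \bar R :=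
  pushforward (@lebesgue_measure R \x m)%E (@cons_row n).

Let mu : {measure set (borel_rV R n.+1) -> \bar R} :=
  measure_function_pushforward__canonical__measure_function_Measure
   (@lebesgue_measure R \x m)%E (@measurable_cons_row n).

Let lebesgue_cons0 : lebesgue_cons set0 = 0%E.
Proof. exact: (measure0 mu). Qed.

Let lebesgue_cons_ge0 A : (0 <= lebesgue_cons A)%E.
Proof. exact: (measure_ge0 mu). Qed.

Let lebesgue_cons_sigma_additive : semi_sigma_additive lebesgue_cons.
Proof. exact: (@measure_semi_sigma_additive _ _ _ mu). Qed.

HB.instance Definition _ := isMeasure.Build _ _ _ lebesgue_cons
  lebesgue_cons0 lebesgue_cons_ge0 lebesgue_cons_sigma_additive.

Let lebesgue_cons_sigma_finite : sigma_finite setT lebesgue_cons.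
Proof.
have /sigma_finiteP[F [FT ndF Foo]] := sigma_finiteT (@lebesgue_measure R).
have /sigma_finiteP[G [GT ndG Goo]] := sigma_finiteT m.
exists (fun k => @head_row n @^-1` F k `&` @tail_row n @^-1` G k).
  apply/esym; rewrite -subTset => u _.
  have [i _ Fi] : (\bigcup_i F i) (head_row u) by rewrite -FT.
  have [j _ Gj] : (\bigcup_j G j) (tail_row u) by rewrite -GT.
  exists (maxn i j) => //; split.
  - by have /subsetPset := ndF _ _ (leq_maxl i j); apply.
  - by have /subsetPset := ndG _ _ (leq_maxr i j); apply.
move=> k; have [mF Foo'] := Foo k; have [mG Goo'] := Goo k; split.
  apply: measurableI.
  - by rewrite -[X in measurable X]setTI; exact: measurable_head_row.
  - by rewrite -[X in measurable X]setTI; exact: measurable_tail_row.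
rewrite /lebesgue_cons /pushforward (_ : _ @^-1` _ = F k `*` G k).
  by rewrite product_measure1E// lte_mul_pinfty// ge0_fin_numE.
by apply/seteqP; split => -[a b]; rewrite /= head_cons tail_cons.
Qed.

HB.instance Definition _ := @Measure_isSigmaFinite.Build _ _ _
  lebesgue_cons lebesgue_cons_sigma_finite.

End Step.

Fixpoint lebesgue_rV n : {sigma_finite_measure set (borel_rV R n) -> \bar R} :=
  match n with
  | 0%N => @dirac _ (borel_rV R 0) (0 : 'rV[R]_0) R
  | n'.+1 => lebesgue_cons (lebesgue_rV n')
  end.

End LebesgueRow.

(* Main.v *)
(** The set [F] has a compact limit of blowups [E] with [dim_H E = dim_A F].
For [s < dim_A F], the blowups of [F] cannot all be covered by finitely many
sets of diameters [r_i] in [[eta, 1/2]] with [\sum r_i ^ s <= 1]: iterating such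
covers would bound [N_r (B(x, rho) `&` F)] by [C (rho / r) ^ s].  Take blowups
[A_n] violating this for [s_n -> dim_A F] and [eta_n -> 0], and let [E] be their
limit along an ultrafilter.  If [H^s(E) = 0] for some [s < dim_A F], then a
finite open cover of [E] of small [s']-sum, for [s < s' < dim_A F], would also
cover many of the [A_n]; hence [dim_H E >= dim_A F].  Conversely, covers of
[p (F)] at the scale of the blowup transfer to [p (E)] for every linear
contraction [p], so [dim_A p(E) <= dim_A p(F)]; the identity gives
[dim_H E <= dim_A E <= dim_A F], and orthogonal projections give the theorem for
every [t] such that [dim_A pi_t E] is at least its essential infimum. *)
Require Import Defs.
From mathcomp Require Import all_boot all_order all_algebra.
From mathcomp Require Import all_classical all_reals all_analysis.
From mathcomp Require Import ess_sup_inf.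
From mathcomp Require Import finmap ring lra.

Import Order.TTheory GRing.Theory Num.Theory.
Import numFieldNormedType.Exports.

Local Open Scope classical_set_scope.
Local Open Scope ring_scope.

(** * Euclidean norm, its topology, and orthogonal projections *)

Section EuclideanNorm.
Context {R : realType} {d : nat}.
Implicit Types (x y z v : 'rV[R]_d) (A B U : set 'rV[R]_d) (e r : R).

Lemma dotpC x y : dotp x y = dotp y x.
Proof. by apply: eq_bigr => i _; rewrite mulrC. Qed.

Lemma dotpDl x y z : dotp (x + y) z = dotp x z + dotp y z.
Proof. by rewrite -big_split/=; apply: eq_bigr => i _; rewrite mxE mulrDl. Qed.

Lemma dotpZl c x z : dotp (c *: x) z = c * dotp x z.
Proof.
by rewrite /dotp mulr_sumr; apply: eq_bigr => i _; rewrite mxE mulrA.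
Qed.

Lemma dotpDr x y z : dotp z (x + y) = dotp z x + dotp z y.
Proof. by rewrite dotpC dotpDl !(dotpC z). Qed.

Lemma dotpZr c x z : dotp z (c *: x) = c * dotp z x.
Proof. by rewrite dotpC dotpZl (dotpC z). Qed.

Lemma dotp_ge0 x : 0 <= dotp x x.
Proof. by apply: sumr_ge0 => i _; rewrite -expr2 sqr_ge0. Qed.

Lemma dotp_eq0 x : dotp x x = 0 -> x = 0.
Proof.
move=> /eqP; rewrite psumr_eq0 => [/allP x0|i _]; last first.
  by rewrite -expr2 sqr_ge0.
apply/rowP => i; rewrite mxE; have /implyP/(_ isT) := x0 i (mem_index_enum _).
by rewrite mulf_eq0 orbb => /eqP.
Qed.

Lemma enorm_ge0 x : 0 <= enorm x.
Proof. exact: sqrtr_ge0. Qed.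

Lemma enorm_sqr x : enorm x ^+ 2 = dotp x x.
Proof. by rewrite sqr_sqrtr// dotp_ge0. Qed.

Lemma enorm0 : enorm (0 : 'rV[R]_d) = 0.
Proof. by rewrite /enorm /dotp big1 ?sqrtr0// => i _; rewrite mxE mul0r. Qed.

Lemma enormZ c x : enorm (c *: x) = `|c| * enorm x.
Proof.
by rewrite /enorm dotpZl dotpZr mulrA -expr2 sqrtrM ?sqr_ge0// sqrtr_sqr.
Qed.

Lemma enormN x : enorm (- x) = enorm x.
Proof. by rewrite -scaleN1r enormZ normrN1 mul1r. Qed.

Lemma enormB x y : enorm (x - y) = enorm (y - x).
Proof. by rewrite -enormN opprB. Qed.

Lemma cauchy_schwarz x y : dotp x y <= enorm x * enorm y.
Proof.
have [y0|y0] := eqVneq (dotp y y) 0.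
  have -> := dotp_eq0 _ y0; rewrite enorm0 mulr0.
  by rewrite /dotp big1// => i _; rewrite mxE mulr0.
have yp : 0 < dotp y y by rewrite lt_neqAle eq_sym y0 dotp_ge0.
rewrite (le_trans (ler_norm _))// -ler_sqr ?nnegrE ?mulr_ge0 ?enorm_ge0//.
rewrite real_normK ?num_real// exprMn !enorm_sqr.
have := dotp_ge0 (dotp y y *: x + (- dotp x y) *: y).
rewrite !(dotpDl, dotpDr, dotpZl, dotpZr) (dotpC y x).
set a := dotp x x; set b := dotp x y; set c := dotp y y => h.
have {h} : 0 <= c * (a * c - b ^+ 2) by move: h; nra.
by rewrite pmulr_rge0// subr_ge0.
Qed.

Lemma enormD x y : enorm (x + y) <= enorm x + enorm y.
Proof.
rewrite -ler_sqr ?nnegrE ?addr_ge0 ?enorm_ge0// enorm_sqr sqrrD.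
rewrite !(dotpDl, dotpDr) !enorm_sqr (dotpC y x).
by have := cauchy_schwarz x y; lra.
Qed.

Lemma enorm_distD x y z : enorm (x - z) <= enorm (x - y) + enorm (y - z).
Proof. by rewrite -[x - z](subrKA y) enormD. Qed.

Lemma coord_le_enorm x i : `|x 0 i| <= enorm x.
Proof.
rewrite -ler_sqr ?nnegrE ?enorm_ge0// real_normK ?num_real// enorm_sqr.
rewrite /dotp (bigD1 i)//= -expr2 lerDl.
by apply: sumr_ge0 => j _; rewrite -expr2 sqr_ge0.
Qed.

Lemma enorm_le_coord x e : 0 <= e -> (forall i, `|x 0 i| <= e) ->
  enorm x <= e * d%:R.
Proof.
move=> e0 xe; rewrite -ler_sqr ?nnegrE ?mulr_ge0 ?enorm_ge0// enorm_sqr.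
have : dotp x x <= \sum_(i < d) e ^+ 2.
  apply: ler_sum => i _; rewrite -expr2 -real_normK ?num_real//.
  by rewrite ler_sqr ?nnegrE.
rewrite sumr_const card_ord => /le_trans; apply.
rewrite exprMn -[leLHS]mulr_natr ler_wpM2l ?sqr_ge0//.
by rewrite -natrX ler_nat; case: (d) => // m; rewrite leq_pmulr.
Qed.

Definition oeball x e : set 'rV[R]_d := [set y | enorm (y - x) < e].

(** The ambient topology is that of the sup norm; the coordinate bounds above make the two norms
    comparable. *)
Lemma nbhs_enormP x U :
  nbhs x U <-> exists2 e : R, 0 < e & oeball x e `<=` U.
Proof.
split.
  move=> /nbhs_ballP[e /= e0 eU]; exists e => // y xy; apply: eU.
  split=> // i j; rewrite ord1 /ball/= distrC; apply: le_lt_trans xy.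
  by have := coord_le_enorm (y - x) j; rewrite !mxE.
move=> [e e0 eU]; apply/nbhs_ballP; exists (e / 2 / (d.+1)%:R) => /=.
  by rewrite !divr_gt0.
move=> y [_ xy]; apply: eU; rewrite /oeball/=.
apply: (@le_lt_trans _ _ (e / 2 / d.+1%:R * d%:R)).
  apply: enorm_le_coord => [|i]; first by rewrite !divr_ge0// ltW.
  by rewrite !mxE distrC ltW//; exact: (xy 0 i).
rewrite mulrAC ltr_pdivrMr// -[in ltRHS]natr1.
have := mulr_ge0 (ltW e0) (ler0n R d).
by lra.
Qed.

(** Makes an arbitrary piece open, as covers require, at the cost of at most [2 * e] in diameter. *)
Definition thickening A e : set 'rV[R]_d :=
  [set y | exists2 a, A a & enorm (y - a) < e].

Lemma open_thickening A e : open (thickening A e).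
Proof.
rewrite openE => y [a Aa ya]; apply/nbhs_enormP; exists (e - enorm (y - a)).
  by rewrite subr_gt0.
move=> z zy; exists a => //; rewrite /oeball/= in zy.
by have := enorm_distD z y a; lra.
Qed.

Lemma oeballE x e : oeball x e = thickening [set x] e.
Proof. by apply/seteqP; split => [y xy|y [_ -> ]//]; exists x. Qed.

Lemma open_oeball x e : open (oeball x e).
Proof. by rewrite oeballE; exact: open_thickening. Qed.

Lemma nbhs_oeball x e : 0 < e -> nbhs x (oeball x e).
Proof. by move=> e0; apply/nbhs_enormP; exists e. Qed.

Lemma compact_eball x r : compact (eball x r).
Proof.
apply: bounded_closed_compact.
  exists (r + enorm x); split; first exact: num_real.
  move=> M rM y /= yr.
  have yM : enorm y <= M.
    by have := enorm_distD y x 0; rewrite !subr0; rewrite /eball/= in yr; lra.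
  rewrite [leLHS]mx_normrE; apply/bigmax_leP; split=> [|[i j] _] /=.
    exact: le_trans (enorm_ge0 _) yM.
  by rewrite ord1; apply: le_trans (coord_le_enorm _ _) yM.
rewrite -(setCK (eball x r)); apply: open_closedC; rewrite openE => y /= yr.
apply/nbhs_enormP; exists (enorm (y - x) - r).
  by rewrite subr_gt0 ltNge; exact/negP.
move=> z; rewrite /oeball/eball/= => zy zx; rewrite (enormB z y) in zy.
by have := enorm_distD y z x; lra.
Qed.

Lemma ediam_leP A r :
  (ediam A <= r%:E)%E <-> forall x y, A x -> A y -> enorm (x - y) <= r.
Proof.
split=> [Ar x y Ax Ay|Ar].
  rewrite -lee_fin; apply: le_trans Ar; apply: ereal_sup_ubound.
  by exists (x, y).
by apply: ge_ereal_sup => _ [[x y] [/= Ax Ay] <-]; rewrite lee_fin Ar.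
Qed.

Lemma ediam_thickening A r e : (ediam A <= r%:E)%E ->
  (ediam (thickening A e) <= (r + 2 * e)%:E)%E.
Proof.
move/ediam_leP => Ar; apply/ediam_leP => x y [a Aa xa] [b Ab yb].
have := enorm_distD x a y; have := enorm_distD a b y.
by have := Ar _ _ Aa Ab; move: yb; rewrite (enormB y b); lra.
Qed.

Lemma ediam_oeball x e : 0 <= e -> (ediam (oeball x e) <= (2 * e)%:E)%E.
Proof.
move=> e0; rewrite oeballE -[2 * e]add0r; apply: ediam_thickening.
by apply/ediam_leP => _ _ -> ->; rewrite subrr enorm0.
Qed.

(** The defect of linearity [w] lies in [V] and is a combination of residuals [x - p x], so it is
    orthogonal to itself. *)
Lemma orthogonal_projection_linear (V : {vspace 'rV[R]_d}) p :
  orthogonal_projection_on V p ->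
  linear p.
Proof.
move=> Vp c x y; apply/eqP; rewrite -subr_eq0; apply/eqP/dotp_eq0.
set w := (X in dotp X X).
have Vw : w \in V.
  by rewrite rpredB ?rpredD ?rpredZ//; [have [] := Vp (c *: x + y)
    |have [] := Vp x|have [] := Vp y].
have [_ /(_ _ Vw) h1] := Vp (c *: x + y).
have [_ /(_ _ Vw) h2] := Vp x.
have [_ /(_ _ Vw) h3] := Vp y.
have {1}-> : w =
    c *: (x - p x) + (y - p y) + (-1) *: (c *: x + y - p (c *: x + y)).
  by apply/rowP => i; rewrite /w !mxE; ring.
by rewrite dotpDl dotpDl !dotpZl h1 h2 h3; ring.
Qed.

Lemma orthogonal_projection_contract (V : {vspace 'rV[R]_d}) p x :
  orthogonal_projection_on V p ->
  enorm (p x) <= enorm x.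
Proof.
move=> /(_ x)[Vpx /(_ _ Vpx) qp].
rewrite -ler_sqr ?nnegrE ?enorm_ge0// !enorm_sqr -[in leRHS](subrK (p x) x).
rewrite dotpDl !(dotpDr (x - p x) (p x)) qp (dotpC (p x) (x - p x)) qp.
by have := dotp_ge0 (x - p x); lra.
Qed.

End EuclideanNorm.

(** * Covering numbers and the multiscale bound on Assouad dimension *)

Section Covering.
Context {R : realType} {d : nat}.
Implicit Types (A B E F : set 'rV[R]_d) (r s c : R).

Lemma covers_with_sub r A B m : A `<=` B -> covers_with r B m ->
  covers_with r A m.
Proof.
by move=> AB [U [Ur BU]]; exists U; split => //; exact: subset_trans BU.
Qed.

Lemma covers_with0 r : @covers_with R d r set0 0.
Proof. by exists (fun=> set0); split => [[]|//]. Qed.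

Lemma covers_with1 r A B : A `<=` B -> open B -> (ediam B <= r%:E)%E ->
  covers_with r A 1.
Proof.
move=> AB oB Br; exists (fun=> B); split=> // x Ax.
by exists ord0 => //; exact: AB.
Qed.

Lemma covers_withU r A B m n : covers_with r A m -> covers_with r B n ->
  covers_with r (A `|` B) (m + n).
Proof.
move=> [U [Ur AU]] [V [Vr BV]].
exists (fun i => match fintype.split i with inl j => U j | inr j => V j end).
split=> [i|x [/AU[i _ Ux]|/BV[i _ Vx]]]; first by case: fintype.split.
- by exists (lshift n i) => //; rewrite (unsplitK (inl i)).
- by exists (rshift m i) => //; rewrite (unsplitK (inr i)).
Qed.

Lemma covers_with_bigcup r m (A : 'I_m -> set 'rV[R]_d) (M : 'I_m -> nat) :
  (forall i, covers_with r (A i) (M i)) ->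
  covers_with r (\bigcup_i A i) (\sum_i M i).
Proof.
elim: m A M => [|m IH] A M AM.
  by rewrite big_ord0; apply: covers_with_sub (covers_with0 r) => x [[]].
rewrite big_ord_recl.
have := covers_withU r _ _ _ _ (AM ord0)
  (IH (A \o lift ord0) (M \o lift ord0) (fun i => AM (lift ord0 i))).
apply: covers_with_sub => x [i _ Ax].
by case: (unliftP ord0 i) Ax => [j|] -> Ax; [right; exists j|left].
Qed.

(** An infimum of naturals is attained, unless no finite cover exists; then it is [+oo], which no
    real [c] bounds. *)
Lemma covering_number_leP r E c : (covering_number r E <= c%:E)%E <->
  exists2 m, covers_with r E m & m%:R <= c.
Proof.
split=> [Ec|[m Em mc]]; last first.
  apply: (@le_trans _ _ (m%:R)%:E); last by rewrite lee_fin.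
  by apply: ereal_inf_lbound; exists m.
have [[m0 Em0]|nE] := pselect (exists m, covers_with r E m); last first.
  move: Ec; rewrite /covering_number (_ : image _ _ = set0).
    by rewrite ereal_inf0 leNgt ltry.
  by rewrite -subset0 => z [m Em _]; apply: nE; exists m.
have exE : exists m, `[< covers_with r E m >] by exists m0; apply/asboolP.
case: (ex_minnP exE) => m /asboolP Em mmin; exists m => //.
rewrite -lee_fin; apply: le_trans Ec; apply: le_ereal_inf_tmp.
by move=> _ [k Ek <-]; rewrite lee_fin ler_nat mmin//; apply/asboolP.
Qed.

Definition assouad_bound F s c := forall rho r : R, 0 < r -> r < rho ->
  forall x, F x -> exists2 m, covers_with r (eball x rho `&` F) m &
    m%:R <= c * (rho / r) `^ s.

Lemma assouad_dim_le F s c : 0 <= s -> 0 < c -> assouad_bound F s c ->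
  (assouad_dim F <= s%:E)%E.
Proof.
move=> s0 c0 Fsc; apply: ereal_inf_lbound; exists s => //; split=> //.
by exists c => // rho r r0 rrho x Fx; apply/covering_number_leP/Fsc.
Qed.

Lemma le_assouad_dim F (a : \bar R) :
  (forall s c, 0 <= s -> 0 < c -> assouad_bound F s c -> (a <= s%:E)%E) ->
  (a <= assouad_dim F)%E.
Proof.
move=> aF; apply: le_ereal_inf_tmp => _ [s [s0 [c c0 Fsc]] <-].
apply: (aF s c) => // rho r r0 rrho x Fx.
exact/covering_number_leP/Fsc.
Qed.

Lemma assouad_dim_ge0 F : (0 <= assouad_dim F)%E.
Proof. by apply: le_assouad_dim => s c s0 _ _; rewrite lee_fin. Qed.

(** The bound [2^-1] forces refinements to shrink geometrically; [eta] prevents them from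
    overshooting the target scale. *)
Definition multiscale_cover (eta s : R) A := exists m,
  exists2 U : 'I_m -> set 'rV[R]_d, A `<=` \bigcup_i U i &
  exists2 r : 'I_m -> R,
    (forall i, [/\ eta <= r i, r i <= 2^-1 & (ediam (U i) <= (r i)%:E)%E]) &
    \sum_i r i `^ s <= 1.

Definition blowup F x (rho : R) : set 'rV[R]_d :=
  [set y | F (x + rho *: y) /\ enorm y <= 1].

(* Refining the covers recursively until the scale [r] is reached multiplies
   [\sum rho_i ^ s] by at most [1] at each step, whence at most
   [C * (rho / r) ^ s] pieces. *)
Lemma assouad_dim_multiscale F (eta s : R) : 0 < eta -> 0 <= s ->
  (forall x (rho : R), F x -> 0 < rho ->
    multiscale_cover eta s (blowup F x rho)) ->
  (assouad_dim F <= s%:E)%E.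
Proof.
move=> eta0 s0 Fmc.
(* For [eta > 1/2] the hypothesis is contradictory, as [0] is in the blowup. *)
have [eta1|eta1] := ltP 2^-1 eta.
  apply: (assouad_dim_le _ _ 1) => // rho r r0 rrho x Fx.
  have [m [U AU [t tP _]]] := Fmc x rho Fx (lt_trans r0 rrho).
  have [|i _ _] := AU 0; first by split; rewrite ?scaler0 ?addr0 ?enorm0.
  by have [+ + _] := tP i; lra.
(* Base case: one open ball of radius [r / 2] suffices, and the factor [4 / eta] makes the bound at
   least 1. *)
have small (rho r : R) x : 0 < r -> rho <= r / 4 -> eta * (r / 4) <= rho ->
    exists2 M, covers_with r (eball x rho `&` F) M &
      M%:R <= (4 / eta * (rho / r)) `^ s.
  move=> r0 rhor rhoe; exists 1%N.
    apply: (covers_with1 _ _ (oeball x (r / 2))) => [y [xy _]||].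
    - by rewrite /oeball/=; rewrite /eball/= in xy; lra.
    - exact: open_oeball.
    - by apply: le_trans (ediam_oeball _ _ _) _; rewrite ?lee_fin; lra.
  have h1 : 1 <= 4 / eta * (rho / r).
    by rewrite mulrACA -invfM ler_pdivlMr ?mulr_gt0//; lra.
  have -> : 1%:R = 1 `^ s :> R by rewrite powR1.
  by rewrite ge0_ler_powR// nnegrE// (le_trans _ h1).
have key m : forall (rho r : R) x, 0 < r -> F x -> rho <= 2 ^+ m * (r / 4) ->
    eta * (r / 4) <= rho ->
    exists2 M, covers_with r (eball x rho `&` F) M &
      M%:R <= (4 / eta * (rho / r)) `^ s.
  elim: m => [|m IH] rho r x r0 Fx rhom rhoe.
    by apply: small => //; rewrite expr0 mul1r in rhom.
  have rho0 : 0 < rho by apply: lt_le_trans rhoe; rewrite mulr_gt0// divr_gt0.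
  have [rhor|rhor] := leP rho (r / 4); first exact: small.
  have [n [U AU [t tP tsum]]] := Fmc x rho Fx rho0.
  pose V i := [set y | U i (rho^-1 *: (y - x))] `&` F.
  have VM i : exists M, covers_with r (eball x rho `&` V i) M /\
      M%:R <= (4 / eta * ((t i * rho) / r)) `^ s.
    have [te th Ut] := tP i.
    have [[z [Uz Fz]]|V0] := pselect (V i !=set0); last first.
      exists 0%N; split; last exact: powR_ge0.
      apply: covers_with_sub (covers_with0 r) => y [_ Vy].
      by apply: V0; exists y.
    (* As [t i <= 2^-1], one factor 2 is used up; as [eta <= t i] and [r / 4 < rho], the new radius
       is still at least [eta * (r / 4)]. *)
    have [||M MV Mr] := IH (t i * rho) r z r0 Fz.
    - by move: rhom; rewrite exprS; nra.
    - by nra.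
    exists M; split=> //.
    apply: covers_with_sub MV => y [_ [Uy Fy]]; split=> //.
    move/ediam_leP : Ut => /(_ _ _ Uy Uz).
    rewrite -scalerBr opprB addrA subrK enormZ gtr0_norm ?invr_gt0//.
    by rewrite ler_pdivrMl// mulrC.
  have [M MP] := choice VM.
  exists (\sum_i M i)%N.
    apply: covers_with_sub (covers_with_bigcup _ _ _ _ (fun i => (MP i).1)).
    move=> y [xy Fy]; have [|i _ Ui] := AU (rho^-1 *: (y - x)).
      split; first by rewrite scalerA divff ?gt_eqF// scale1r addrC subrK.
      by rewrite enormZ gtr0_norm ?invr_gt0// ler_pdivrMl// mulr1.
    by exists i.
  (* The [s]-th powers of the [t i] factor out and sum to at most 1, so the constant does not grow
     with the depth. *)
  rewrite natr_sum; apply: (@le_trans _ _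
    (\sum_i (t i `^ s * (4 / eta * (rho / r)) `^ s))).
    apply: ler_sum => i _; apply: le_trans (MP i).2 _.
    have t0 : 0 <= t i by have [+ _ _] := tP i; apply: le_trans (ltW eta0).
    have g0 : 0 <= 4 / eta * (rho / r) by rewrite !mulr_ge0 ?invr_ge0// ltW.
    by rewrite -powRM// (mulrCA (t i)) (mulrA (t i)).
  by rewrite -mulr_suml ler_piMl ?powR_ge0.
apply: (assouad_dim_le _ _ ((4 / eta) `^ s)) => //.
  by rewrite powR_gt0// divr_gt0.
move=> rho r r0 rrho x Fx.
have [m rhom] : exists m : nat, rho <= 2 ^+ m * (r / 4).
  exists (Num.truncn (rho / (r / 4))).+1; rewrite -ler_pdivrMr ?divr_gt0//.
  apply: (@le_trans _ _ (Num.truncn (rho / (r / 4))).+1%:R).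
    by rewrite ltW// truncnS_gt.
  by rewrite -natrX ler_nat ltnW// ltn_expl.
have [|M MV Mr] := key m rho r x r0 Fx rhom; first by nra.
exists M => //; rewrite -powRM ?divr_ge0//; lra.
Qed.

End Covering.

(** * Limits of sets along an ultrafilter *)

Section Ultralimit.
Context {R : realType} {d : nat}.
Context (G : set_system nat) {UG : UltraFilter G}.
Context (A : nat -> set 'rV[R]_d).

#[local] Instance ultra_properfilter : ProperFilter G := ultra_proper.

(** For sets in one compact set this is a limit in the Hausdorff sense, by [ultralimit_sub_open] and
    [ultralimit_approx]; no subsequence has to be extracted. *)
Definition ultralimit : set 'rV[R]_d :=
  [set x | forall e : R, 0 < e ->
    G [set n | exists2 a, A n a & enorm (a - x) < e]].

Lemma compact_ultra_seq (K : set 'rV[R]_d) (u : nat -> 'rV[R]_d) :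
  compact K -> G [set n | K (u n)] ->
  exists2 x, K x & forall e : R, 0 < e -> G [set n | enorm (u n - x) < e].
Proof.
move=> cK GK; have [x [Kx ux]] := cK (u @ G) _ GK.
exists x => // e e0.
have [//|GC] := in_ultra_setVsetC [set n | enorm (u n - x) < e] UG.
by have [y [yC]] := ux (~` oeball x e) _ GC (nbhs_oeball x e e0).
Qed.

Lemma closed_ultralimit : closed ultralimit.
Proof.
move=> x clx e e0; have e20 : 0 < e / 2 by rewrite divr_gt0.
have [y [Ey xy]] := clx _ (nbhs_oeball x _ e20).
apply: filterS (Ey _ e20) => n [a Aa ay]; exists a => //.
by have := enorm_distD a y x; rewrite /oeball/= in xy; lra.
Qed.

Context (K : set 'rV[R]_d) (cK : compact K) (AK : forall n, A n `<=` K).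

Lemma ultralimit_sub : ultralimit `<=` K.
Proof.
move=> x Ex; apply: (compact_closed (@norm_hausdorff _ _) cK).
move=> B /nbhs_enormP[e e0 eB].
have [n [a Aa ax]] := filter_ex (Ex _ e0).
by exists a; split; [exact: AK Aa|exact: eB].
Qed.

Lemma compact_ultralimit : compact ultralimit.
Proof. exact: subclosed_compact closed_ultralimit cK ultralimit_sub. Qed.

(** Otherwise [G]-many [A n] have a point outside [V]; the limit of these points lies in the
    ultralimit, hence in the open set [V], which then contains some of them. *)
Lemma ultralimit_sub_open V : open V -> ultralimit `<=` V ->
  G [set n | A n `<=` V].
Proof.
move=> oV EV; have [//|GC] := in_ultra_setVsetC [set n | A n `<=` V] UG.
have /choice[u uP] n : exists v, ~ (A n `<=` V) -> A n v /\ ~ V v.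
  have [AV|/existsNP[a /not_implyP[Aa Va]]] := pselect (A n `<=` V).
    by exists 0.
  by exists a.
have [|x Kx ux] := compact_ultra_seq K u cK.
  by apply: filterS GC => n /uP[/AK].
have Ex : ultralimit x.
  move=> e /ux; apply: filterS2 GC => n /uP[Au _] ue.
  by exists (u n).
have /nbhs_enormP[e e0 eV] := open_nbhs_nbhs (conj oV (EV _ Ex)).
have [n [/uP[_ uV] /eV]] := filter_ex (filterI GC (ux _ e0)).
by [].
Qed.

(** Compactness makes the approximation uniform: badly approximated points [u n] would converge to
    some [x], which for some [n] is within [e / 2] of both [u n] and [A n]. *)
Lemma ultralimit_approx (e : R) : 0 < e ->
  G [set n | forall x, ultralimit x -> exists2 a, A n a & enorm (a - x) < e].
Proof.
move=> e0; set S := (X in G X).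
have [//|GC] := in_ultra_setVsetC S UG.
have /choice[u uP] n : exists v, ~ S n ->
    ultralimit v /\ forall a, A n a -> e <= enorm (a - v).
  have [Sn|/existsNP[x /not_implyP[Ex nx]]] := pselect (S n).
    by exists 0.
  exists x => _; split=> // a Aa; rewrite leNgt; apply/negP => ae.
  by apply: nx; exists a.
have [|x Ex ux] := compact_ultra_seq _ u compact_ultralimit.
  by apply: filterS GC => n /uP[].
have e20 : 0 < e / 2 by rewrite divr_gt0.
have [n [[/uP[_ ue] un] [a Aa ax]]] :=
  filter_ex (filterI (filterI GC (ux _ e20)) (Ex _ e20)).
have := ue _ Aa; have := enorm_distD a x (u n); rewrite (enormB x).
by rewrite /= in un; lra.
Qed.

End Ultralimit.

(** * Hausdorff measure, compared with Assouad dimension and multiscale covers *)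

Section Dimensions.
Context {R : realType} {d : nat}.
Implicit Types (A B E F : set 'rV[R]_d) (r s c : R).

Lemma powR_root (x s : R) : 0 < x -> 0 < s ->
  0 < x `^ s^-1 /\ (x `^ s^-1) `^ s = x.
Proof.
move=> x0 s0; split; first exact: powR_gt0.
by rewrite -powRrM mulVf ?gt_eqF// powRr1// ltW.
Qed.

(** All [r i] lie between 0 and 1, so a larger exponent only lowers the sum. *)
Lemma multiscale_cover_sub A B eta eta' s s' : A `<=` B -> eta' <= eta ->
  0 < eta -> s <= s' -> multiscale_cover eta s B -> multiscale_cover eta' s' A.
Proof.
move=> AB ee eta0 ss [m [U BU [r rP rsum]]].
exists m, U; first exact: subset_trans BU.
exists r => [i|].
  by have [ri rh Ur] := rP i; split=> //; exact: le_trans ri.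
apply: le_trans rsum; apply: ler_sum => i _; have [ri rh _] := rP i.
by apply: ger_powR => //; lra.
Qed.

Lemma ediam_ge0 A : A !=set0 -> (0 <= ediam A)%E.
Proof.
move=> [x Ax]; apply: ereal_sup_ubound; exists (x, x) => //.
by rewrite subrr enorm0.
Qed.

Lemma ediam_set0 : ediam (@set0 'rV[R]_d) = -oo%E.
Proof.
rewrite /ediam (_ : image _ _ = set0) ?ereal_sup0//.
by rewrite -subset0 => _ [z [[]]].
Qed.

Lemma diam_pow_ge0 s A : (0 <= diam_pow s A)%E.
Proof. by rewrite /diam_pow; case: ifP => // _; exact: poweR_ge0. Qed.

Lemma diam_pow_le s r A : 0 <= s -> (ediam A <= r%:E)%E ->
  (diam_pow s A <= (r `^ s)%:E)%E.
Proof.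
move=> s0 Ar; rewrite /diam_pow; case: ifPn => [_|/set0P/ediam_ge0 A0].
  by rewrite lee_fin powR_ge0.
rewrite -poweR_EFin gt0_ler_poweR// in_itv/= leey andbT//.
exact: le_trans Ar.
Qed.

(** [fine] sends the diameter [-oo] of the empty set to 0, and [0 < s'] makes the power of 0
    vanish. *)
Lemma diam_pow_ge s s' A : s <= s' -> 0 < s' -> (ediam A <= 1)%E ->
  (((fine (ediam A)) `^ s')%:E <= diam_pow s A)%E.
Proof.
move=> ss s'0 A1; rewrite /diam_pow; case: eqVneq => [->|/set0P/ediam_ge0].
  by rewrite ediam_set0/= powR0// gt_eqF.
case: (ediam A) A1 => //= r r1; rewrite lee_fin => r0.
rewrite lee_fin; move: r0; rewrite le_eqVlt => /predU1P[<-|r0].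
  by rewrite powR0 ?powR_ge0// gt_eqF.
by rewrite ger_powR// r0.
Qed.

Lemma hausdorff_content_ge0 s delta E : (0 <= hausdorff_content s delta E)%E.
Proof.
apply: le_ereal_inf_tmp => _ [U _ <-].
by apply: nneseries_ge0 => n _ _; exact: diam_pow_ge0.
Qed.

Lemma hausdorff_content_covers_with s delta r E m : 0 <= s -> r <= delta ->
  covers_with r E m -> (hausdorff_content s delta E <= (m%:R * r `^ s)%:E)%E.
Proof.
move=> s0 rd [U [Ur EU]].
(* The finite cover is padded with empty sets, which contribute 0 even for [s = 0]. *)
pose V k := if insub k is Some i then U i else set0.
have VE (i : 'I_m) : V i = U i by rewrite /V valK.
have V0 k : (m <= k)%N -> V k = set0.
  by move=> mk; rewrite /V insubN// -leqNgt.
have le_sum : (\sum_(0 <= k <oo) diam_pow s (V k) <= (m%:R * r `^ s)%:E)%E.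
  rewrite (nneseries_split 0 m); last by move=> k _; exact: diam_pow_ge0.
  rewrite add0n [X in (_ + X)%E]eseries0 ?adde0; last first.
    by move=> i mi _; rewrite V0// /diam_pow eqxx.
  rewrite big_mkord (@le_trans _ _ (\sum_(i < m) (r `^ s)%:E)%E)//.
    apply: lee_sum => i _; rewrite VE.
    by apply: diam_pow_le => //; case: (Ur i).
  by rewrite sumEFin sumr_const card_ord mulr_natl.
apply: le_trans le_sum; apply: ereal_inf_lbound; exists V => //; split=> [k|x].
  rewrite /V; case: insubP => [i _ _|_]; last by rewrite ediam_set0 leNye.
  by case: (Ur i) => _ /le_trans; apply; rewrite lee_fin.
by move=> /EU[i _ Ux]; exists i => //; rewrite VE.
Qed.

(** [E] lies in one ball of radius [rho + 1], so its covers at scale [r] have an [(s + e)]-sum of at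
    most a constant times the [e]-th power of [r]. *)
Lemma hausdorff_dim_le_assouad E rho : E !=set0 -> (forall x y, E x -> E y ->
  enorm (x - y) <= rho) -> (hausdorff_dim E <= assouad_dim E)%E.
Proof.
move=> [x Ex] Erho; apply: le_assouad_dim => s c s0 c0 Esc.
apply/lee_addgt0Pr => e e0; rewrite -EFinD; apply: ereal_inf_lbound.
exists (s + e) => //; split; first by rewrite addr_ge0// ltW.
apply/eqP; rewrite eq_le; apply/andP; split; last first.
  apply: le_trans (hausdorff_content_ge0 (s + e) 1 E) _.
  by apply: ereal_sup_ubound; exists 1 => //=.
apply: ge_ereal_sup => _ [delta /= d0 <-]; apply/lee_addgt0Pr => h h0.
rewrite add0e.
have rho0 : 0 <= rho by apply: le_trans (enorm_ge0 _) (Erho _ _ Ex Ex).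
pose q := c * (rho + 1) `^ s.
have q0 : 0 < q by rewrite mulr_gt0// powR_gt0//; lra.
have [t0 te] := powR_root (h / q) e (divr_gt0 h0 q0) e0.
set t := _ `^ _ in t0 te.
(* [delta] makes the cover admissible, [2^-1] gives [r < rho + 1], and [t] brings the sum below
   [h]. *)
pose r := Order.min (Order.min delta (2^-1)) t.
have r0 : 0 < r by rewrite !lt_min d0 t0 invr_gt0/=; lra.
have [rd rh] : r <= delta /\ r <= 2^-1.
  by split; rewrite /r !ge_min lexx ?orbT.
have rt : r <= t by rewrite /r ge_min lexx orbT.
have [|m Em mc] := Esc (rho + 1) r r0 _ x Ex; first by lra.
have Em' : covers_with r E m.
  apply: covers_with_sub Em => y Ey; split=> //.
  by have := Erho _ _ Ey Ex; rewrite /eball/=; lra.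
apply: le_trans (hausdorff_content_covers_with (s + e) _ _ _ _ _ rd Em') _.
  by rewrite addr_ge0// ltW.
rewrite lee_fin (@le_trans _ _ (q * r `^ e))//.
  have -> : q * r `^ e = (c * ((rho + 1) / r) `^ s) * r `^ (s + e).
    have rs : ((rho + 1) / r) `^ s * r `^ s = (rho + 1) `^ s.
      by rewrite -powRM ?divr_ge0 ?(ltW r0) ?divfK ?gt_eqF//; lra.
    by rewrite powRD ?(gt_eqF r0) ?implybT// /q -rs; ring.
  by rewrite ler_wpM2r ?powR_ge0.
have -> : h = q * t `^ e by rewrite te mulrC divfK// gt_eqF.
by rewrite ler_pM2l// ge0_ler_powR// ?nnegrE ltW.
Qed.

(** With diameters at most 1, passing from [s] to [s'] does not increase the sum, and [0 < s'] makes
    small enlargements cheap. Covering an open [V] lets every set inside [V] inherit the cover. *)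
Lemma hausdorff_null_multiscale E s s' : compact E -> 0 <= s -> s < s' ->
  hausdorff_measure s E = 0%E ->
  exists V eta, [/\ open V, E `<=` V, 0 < eta & multiscale_cover eta s' V].
Proof.
move=> cE s0 ss HE0; have s'0 : 0 < s' by apply: le_lt_trans ss.
(* One [kap] pays for the cover, another for the enlargements [t k]; after doubling all diameters,
   the total is the [s']-th power of [2^-1], which also forces each [r k <= 2^-1]. *)
pose kap : R := (2^-1) `^ s' / 2 `^ s' / 2.
have k0 : 0 < kap by rewrite !divr_gt0 ?powR_gt0.
have : (hausdorff_content s 1 E < kap%:E)%E.
  apply: (@le_lt_trans _ _ (hausdorff_measure s E)); last first.
    by rewrite HE0 lte_fin.
  by apply: ereal_sup_ubound; exists 1 => //=.
move=> /ereal_inf_lt[_ [U [U1 EU] <-] Uk].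
pose del k := fine (ediam (U k)).
have del0 k : 0 <= del k.
  have [/ediam_ge0|] := pselect (U k !=set0); first exact: fine_ge0.
  by move/nonemptyPn => Uk0; rewrite /del Uk0 ediam_set0.
have Udel k : (ediam (U k) <= (del k)%:E)%E.
  have [/ediam_ge0 U0|/nonemptyPn ->] := pselect (U k !=set0).
    rewrite fineK// ge0_fin_numE//; exact: le_lt_trans (U1 k) (ltry _).
  by rewrite ediam_set0 leNye.
pose t k := (kap / (2 ^ k.+1)%:R) `^ s'^-1.
have kk0 k : 0 < kap / (2 ^ k.+1)%:R by rewrite divr_gt0// ltr0n expn_gt0.
have tP k : 0 < t k /\ t k `^ s' = kap / (2 ^ k.+1)%:R by exact: powR_root.
pose mx k := Order.max (del k) (t k).
have mxd k : del k <= mx k by rewrite /mx le_max lexx.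
have mxt k : t k <= mx k by rewrite /mx le_max lexx orbT.
have mx0 k : 0 < mx k by apply: lt_le_trans (mxt k); have [] := tP k.
have mxpow k :
    ((mx k `^ s')%:E <= diam_pow s (U k) + (kap / (2 ^ k.+1)%:R)%:E)%E.
  have dp : ((del k `^ s')%:E <= diam_pow s (U k))%E.
    by apply: diam_pow_ge => //; exact: ltW.
  have [_ tk] := tP k; rewrite /mx; case: (leP (del k) (t k)) => _.
    by rewrite tk leeDr// diam_pow_ge0.
  by apply: le_trans dp _; rewrite leeDl// lee_fin ltW.
(* Enlarging [U k] to diameter [r k > 0] makes the cover open, so that [E] has a
   finite subcover, whose smallest diameter is then bounded below. *)
pose r k := 2 * mx k.
have rsum N : \sum_(k < N) r k `^ s' <= (2^-1) `^ s'.
  have -> : (2^-1) `^ s' = 2 `^ s' * (kap + kap).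
    by rewrite /kap -splitr mulrC divfK// gt_eqF// powR_gt0.
  under eq_bigr do rewrite powRM ?(ltW (mx0 _))//.
  rewrite -mulr_sumr ler_wpM2l ?powR_ge0// -lee_fin EFinD -sumEFin.
  apply: (@le_trans _ _ (\sum_(0 <= k <oo)
      (diam_pow s (U k) + (kap / (2 ^ k.+1)%:R)%:E))%E).
    rewrite -(big_mkord xpredT (fun k => (mx k `^ s')%:E)).
    apply: le_trans (nneseries_lim_ge N _); last first.
      by move=> k _ _; rewrite adde_ge0 ?diam_pow_ge0// lee_fin ltW.
    by apply: lee_sum => k _; exact: mxpow.
  apply: le_trans (epsilon_trick _ _ _) _; [|exact: ltW|].
    by move=> k; exact: diam_pow_ge0.
  by rewrite leeD2r// ltW.
pose V k := thickening (U k) (mx k / 2).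
have EV : E `<=` \bigcup_k V k.
  move=> x /EU[k _ Ux]; exists k => //; exists x => //.
  by rewrite subrr enorm0 divr_gt0.
have [D _ ED] : finite_subset_cover [set: nat] V E.
  by move: cE; rewrite compact_cover; apply => // k _; exact: open_thickening.
(* Keeping every index below [N] gives a cover indexed by ['I_N]; as [t] decreases, [t N] bounds all
   its [r i] from below. *)
have [N DN] : exists N, forall k : nat, k \in D -> (k < N)%N.
  exists (\max_(k <- D) k).+1 => k kD; rewrite ltnS.
  exact: (@leq_bigmax_seq _ _ xpredT id).
exists (\bigcup_(k < N) V k), (t N); split.
- by apply: bigcup_open => k _; exact: open_thickening.
- by move=> x /ED[k kD Vx]; exists k => //; exact: DN.
- by have [] := tP N.
exists N, V; first by move=> x [k /= kN Vx]; exists (Ordinal kN).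
exists r => [i|]; last first.
  apply: le_trans (rsum N) _; have s1 : 1 = 1 `^ s' :> R by rewrite powR1.
  by rewrite [leRHS]s1 ge0_ler_powR ?nnegrE ?invr_ge0 ?(ltW s'0)//; lra.
split.
- have : t N <= t i.
    rewrite ge0_ler_powR ?invr_ge0 ?nnegrE ?(ltW s'0) ?(ltW (kk0 _))//.
    rewrite ler_pM2l// lef_pV2 ?posrE ?ltr0n ?expn_gt0// ler_nat leq_exp2l//.
    by rewrite ltnS ltnW.
  by have := mxt i; have := mx0 i; rewrite /r; lra.
- have ri : r i `^ s' <= (2^-1) `^ s'.
    apply: le_trans (rsum N); rewrite (bigD1 i)//= lerDl.
    by apply: sumr_ge0 => k _; exact: powR_ge0.
  rewrite leNgt; apply/negP => ir; move: ri; rewrite leNgt => /negP; apply.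
  by apply: gt0_ltr_powR => //; rewrite nnegrE; have := mx0 i; rewrite /r; lra.
- apply: le_trans (ediam_thickening _ _ _ (Udel i)) _.
  by rewrite lee_fin; have := mxd i; rewrite /r; lra.
Qed.

End Dimensions.

(** * Limits of blowups and their dimensions *)

Section Tangents.
Context {R : realType} {d : nat}.
Implicit Types (A B E F : set 'rV[R]_d) (r s c : R).

(** Only one side of Hausdorff closeness is asked: it is what transfers covers from [F] to [E]. *)
Definition approximated_by_blowups F E := forall e : R, 0 < e ->
  exists x (t : R), 0 < t /\
    forall y, E y -> exists2 a, blowup F x t a & enorm (a - y) < e.

(** By linearity [p] respects the rescaling, and contraction preserves the closeness of the blowup
    to [E]; so a cover of the image of [F], rescaled and thickened, covers the image of [E].
    Doubling the radius and halving the scale costs the factor 4. *)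
Lemma assouad_dim_tangent_image (p : 'rV[R]_d -> 'rV[R]_d) F E : linear p ->
  (forall x : 'rV[R]_d, enorm (p x) <= enorm x) ->
  approximated_by_blowups F E ->
  (assouad_dim (p @` E) <= assouad_dim (p @` F))%E.
Proof.
move=> lp p1 FE; apply: le_assouad_dim => s c s0 c0 Fsc.
apply: (assouad_dim_le _ _ (c * 4 `^ s)) => //.
  by rewrite mulr_gt0// powR_gt0.
have pB a b : p (a - b) = p a - p b.
  by rewrite -[a - b]addrC -scaleN1r lp scaleN1r addrC.
have pZ x t a : p (x + t *: a) = t *: p a + p x by rewrite addrC lp.
move=> rho r r0 rrho _ [w Ew <-].
(* The error [r / 16] fits both in the thickening by [r / 8] and, counted twice, in the passage from
   radius [rho] to [2 * rho] when the centre moves from [w] to a point [b] of the blowup. *)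
have [|x [t [t0 xE]]] := FE (r / 16); first by rewrite divr_gt0.
have [b [Fb _] bw] := xE _ Ew.
have [|||M [U [Ur FU]] Mc] := Fsc (t * (2 * rho)) (t * (r / 2)) _ _
    (p (x + t *: b)).
- by rewrite mulr_gt0// divr_gt0.
- by rewrite ltr_pM2l//; lra.
- by exists (x + t *: b).
have tB (v y z : 'rV[R]_d) :
    enorm (t *: y + v - (t *: z + v)) = t * enorm (y - z).
  by rewrite opprD addrACA subrr addr0 -scalerBr enormZ gtr0_norm.
pose W i := [set z | U i (t *: z + p x)].
have Wr i : (ediam (W i) <= (r / 2)%:E)%E.
  have [_ /ediam_leP Ui] := Ur i; apply/ediam_leP => y z Uy Uz.
  have := Ui _ _ Uy Uz.
  by rewrite tB ler_pM2l.
exists M.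
  exists (fun i => thickening (W i) (r / 8)); split=> [i|].
    split; first exact: open_thickening.
    apply: le_trans (ediam_thickening _ _ _ (Wr i)) _.
    by rewrite lee_fin; lra.
  move=> z [/= yrho [y Ey yE]]; have [a [Fa _] ay] := xE _ Ey.
  have [|i _ Ui] := FU (p (x + t *: a)).
    split; last by exists (x + t *: a).
    rewrite /eball/= !pZ tB ler_pM2l//.
    have := enorm_distD (p a) (p y) (p b).
    have := enorm_distD (p y) (p w) (p b).
    have := p1 (a - y); have := p1 (w - b); rewrite !pB (enormB w b).
    by rewrite /eball/= -yE in yrho; lra.
  exists i => //; exists (p a); first by rewrite /W/= -pZ.
  by rewrite -yE enormB -pB; apply: le_lt_trans (p1 _) _; lra.
have scaleE : t * (2 * rho) / (t * (r / 2)) = 4 * (rho / r).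
  by field; rewrite !gt_eqF.
have rr0 : 0 <= rho / r by rewrite divr_ge0 ?ltW// (lt_trans r0).
by apply: le_trans Mc _; rewrite scaleE powRM// mulrA.
Qed.

(** Handles finite and infinite dimension at once; [0 <= u n] is what [assouad_dim_multiscale] asks
    of exponents. *)
Lemma le_real_seq (a : \bar R) : (0 < a)%E -> exists u : nat -> R,
  (forall n, 0 <= u n /\ ((u n)%:E < a)%E) /\
  forall s, (s%:E < a)%E -> \forall n \near \oo, s <= u n.
Proof.
case: a => [a||//]; rewrite ?lte_fin => a0.
  exists (fun n => a - a * n.+1%:R^-1); split=> [n|s].
    have n0 : 0 < n.+1%:R^-1 :> R by rewrite invr_gt0.
    have n1 : n.+1%:R^-1 <= 1 :> R by rewrite invf_le1// ler1n.
    by rewrite subr_ge0 lte_fin ltrBlDr ltrDl mulr_gt0// ler_piMr// ltW.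
  rewrite lte_fin => sa.
  have e0 : 0 < (a - s) / a by rewrite divr_gt0// subr_gt0.
  have := near_infty_natSinv_lt (PosNum e0); apply: filterS => n /=.
  by rewrite ltr_pdivlMr// lerBrDr -lerBrDl mulrC => /ltW.
exists (fun n => n%:R); split=> [n|s _]; first by rewrite ltry.
exact: nbhs_infty_ger.
Qed.

Lemma exists_tangent_of_full_dim F : F !=set0 -> exists E,
  [/\ E !=set0, compact E, hausdorff_dim E = assouad_dim F &
      approximated_by_blowups F E].
Proof.
move=> [x0 Fx0].
(* The upper bound is automatic: [E] is bounded, and the tangent estimate applies to [idfun]. *)
suff [E [E0 E1 cE lb FE]] : exists E, [/\ E !=set0, E `<=` eball 0 1, compact E,
    (assouad_dim F <= hausdorff_dim E)%E & approximated_by_blowups F E].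
  exists E; split=> //; apply/eqP; rewrite eq_le lb andbT.
  apply: (@le_trans _ _ (assouad_dim E)).
    apply: (@hausdorff_dim_le_assouad _ _ _ 2) => // x y /E1 + /E1.
    rewrite /eball/= !subr0 => x1 y1.
    by have := enormD x (- y); rewrite enormN; lra.
  have := assouad_dim_tangent_image idfun F E _ _ FE.
  by rewrite !image_id; apply.
(* In dimension 0 no nonnegative exponent lies below the dimension; a single point serves. *)
have [F0|] := eqVneq (assouad_dim F) 0%E.
  exists [set 0]; split.
  - by exists 0.
  - by move=> _ ->; rewrite /eball/= subrr enorm0.
  - exact: compact_set1.
  - rewrite F0; apply: le_ereal_inf_tmp => _ [s [s0 _] <-].
    by rewrite lee_fin.
  - move=> e e0; exists x0, 1; split=> // _ ->; exists 0.
      by split; rewrite ?scaler0 ?addr0 ?enorm0.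
    by rewrite subrr enorm0.
rewrite neq_lt ltNge assouad_dim_ge0/= => /le_real_seq[u [uF ule]].
have /choice[b bP] n : exists b : 'rV[R]_d * R, [/\ F b.1, 0 < b.2 &
    ~ multiscale_cover n.+1%:R^-1 (u n) (blowup F b.1 b.2)].
  apply: contrapT => nb; have [u0] := uF n; apply/negP; rewrite -leNgt.
  apply: (@assouad_dim_multiscale _ _ _ n.+1%:R^-1) => // x rho Fx rho0.
  by apply: contrapT => nmc; apply: nb; exists (x, rho).
pose A n := blowup F (b n).1 (b n).2.
(* [G] refines [\oo], so conditions on large [n] can be combined with those that compactness gives
   along [G]. *)
have [G [UG ooG]] := @ultraFilterLemma _ \oo _.
have PG : ProperFilter G := @ultra_proper _ _ UG.
have A1 n : A n `<=` eball 0 1 by move=> y [_]; rewrite /eball/= subr0.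
have cE := @compact_ultralimit _ _ G UG A _ (compact_eball 0 1) A1.
exists (ultralimit G A); split => //.
(* Blowups are centred at points of [F], so every [A n] contains 0. *)
- exists 0 => e e0; apply: filterS filterT => n _; exists 0.
    by have [Fb _ _] := bP n; split; rewrite ?scaler0 ?addr0 ?enorm0.
  by rewrite subrr enorm0.
- exact: (@ultralimit_sub _ _ G UG A _ (compact_eball 0 1) A1).
- apply: le_ereal_inf_tmp => _ [s [s0 Hs] <-]; rewrite leNgt; apply/negP => sF.
  have [s' ss' s'F] : exists2 s', s < s' & (s'%:E < assouad_dim F)%E.
    case: (assouad_dim F) sF => [a||//]; last first.
      by exists (s + 1); rewrite ?ltry ?ltrDl.
    rewrite lte_fin => sa; exists ((s + a) / 2); last rewrite lte_fin.
      by rewrite ltr_pdivlMr//; lra.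
    by rewrite ltr_pdivrMr//; lra.
  have [V [eta [oV EV eta0 Vmc]]] :=
    hausdorff_null_multiscale _ _ _ cE s0 ss' Hs.
  have GV :=
    @ultralimit_sub_open _ _ G UG A _ (compact_eball 0 1) A1 V oV EV.
  have Gs : G [set n | s' <= u n] := ooG _ (ule _ s'F).
  have Ge : G [set n | n.+1%:R^-1 < eta] :=
    ooG _ (near_infty_natSinv_lt (PosNum eta0)).
  have [n [[/= AV su] ne]] := filter_ex (filterI (filterI GV Gs) Ge).
  have [_ _] := bP n; apply.
  exact: multiscale_cover_sub AV (ltW ne) eta0 su Vmc.
- move=> e e0.
  have [n nE] := filter_ex
    (@ultralimit_approx _ _ G UG A _ (compact_eball 0 1) A1 e e0).
  by have [_ bn0 _] := bP n; exists (b n).1, (b n).2.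
Qed.

End Tangents.

Theorem theorem2p11 (R : realType) (d k n : nat) (hk : (1 <= k)%N)
    (hkd : (k < d)%N)
    (F : set 'rV[R]_d) (F0 : F !=set0)
    (P : set (borel_rV R n)) (mP : measurable P)
    (P_pos : (0 < lebesgue_rV n P)%E)
    (pi_ : borel_rV R n -> ('rV[R]_d -> 'rV[R]_d))
    (pi_grass : forall t, P t -> grassmannian R d k (pi_ t))
    (pi_bij : set_bij P (pi_ @` P) pi_) :
  {ae lebesgue_rV n, forall t, P t ->
    (ereal_inf
       [set ess_inf (mrestr (lebesgue_rV n) mP)
              (fun s => assouad_dim (pi_ s @` E))
       | E in [set E : set 'rV[R]_d | [/\ E !=set0, compact E &
           hausdorff_dim E = assouad_dim F]]]
     <= assouad_dim (pi_ t @` F))%E}.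
Proof.
(* [E] is chosen before [t], so a single exceptional null set suffices. *)
have [E [E0 cE dimE FE]] := exists_tangent_of_full_dim F F0.
have [N [mN N0 subN]] := ess_inf_le (mrestr (lebesgue_rV n) mP)
  (fun s => assouad_dim (pi_ s @` E)).
(* [N] is null for the measure restricted to [P], which says that its intersection with [P] is
   Lebesgue null. *)
exists (N `&` P); split; [exact: measurableI|exact: N0|].
move=> t /= /not_implyP[Pt nle]; split=> //; apply: subN => /= le_t.
apply: nle; apply: (@le_trans _ _ (assouad_dim (pi_ t @` E))).
  by apply: le_trans le_t; apply: ereal_inf_lbound; exists E.
have [V _ piV] := pi_grass t Pt.
apply: assouad_dim_tangent_image FE.
  exact: orthogonal_projection_linear piV.
by move=> x; exact: orthogonal_projection_contract piV.
Qed.
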